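(* For every positive integer $r$ there exist rational numbers $d_r, d_{r+1}, \ldots, d_{2r-1}, e_{r+1}, e_{r+2}, \ldots, e_{2r}$ (depending on $r$ but not on $n$) such that, for every positive integer $n$, $$S_{2r+1}(n) = \frac{r+1}{2}\left(S_r(n)^2 - \sum_{i=r}^{2r-1} d_i\, S_i(n)\right)$$ and $$S_{2r+2}(n) = \frac{(r+1)(r+2)}{2r+3}\left(S_r(n)\,S_{r+1}(n) - \sum_{i=r+1}^{2r} e_i\, S_i(n)\right).$$
   Context: For positive integers $k$ and $n$, $S_k(n) = \sum_{m=1}^n m^k = 1^k + 2^k + \cdots + n^k$. *)

(* Defs.v *)
From mathcomp Require Import all_boot all_order all_algebra.

Set Implicit Arguments.
Unset Strict Implicit.
Unset Printing Implicit Defensive.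

Import GRing.Theory.
Local Open Scope ring_scope.

Definition power_sum (k n : nat) : rat := \sum_(1 <= m < n.+1) m%:R ^+ k.

(* Main.v *)
Require Import Defs.
From mathcomp Require Import all_boot all_order all_algebra.
From mathcomp Require Import ring.

Set Implicit Arguments.
Unset Strict Implicit.
Unset Printing Implicit Defensive.

Import GRing.Theory Num.Theory.
Local Open Scope ring_scope.

(** By Faulhaber, [S_k(n) = n^(k+1)/(k+1) + n^k/2 + n p(n)] with [deg p < k - 1].
    Substituting this in the backward differences
    [S_r(n)^2 - S_r(n-1)^2 = n^r (2 S_r(n) - n^r)] and
    [S_r(n) S_(r+1)(n) - S_r(n-1) S_(r+1)(n-1)
      = n^r S_(r+1)(n) + n^(r+1) S_r(n) - n^(2r+1)],
    the [n^k/2] terms cancel the subtracted powers, which creates the gap below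
    the leading exponent; summing over [n] gives the two identities. *)

Lemma power_sum0 k : power_sum k 0 = 0.
Proof. by rewrite /power_sum big_geq. Qed.

Lemma power_sumS k n : power_sum k n.+1 = power_sum k n + n.+1%:R ^+ k.
Proof. by rewrite /power_sum big_nat_recr. Qed.

(** Telescoping: a function vanishing at 0 is determined by its backward differences, and that of
    [power_sum i] is the monomial of exponent [i]. It reduces [exprn_power_sum] and both final
    identities to polynomial identities in [n.+1]. *)
Lemma sum_differences (F : nat -> rat) (c : rat) (d : nat -> rat) (k l h : nat) :
    F 0%N = 0 ->
    (forall n, F n.+1 - F n =
       c * n.+1%:R ^+ k + \sum_(l <= i < h) d i * n.+1%:R ^+ i) ->
  forall n, F n = c * power_sum k n + \sum_(l <= i < h) d i * power_sum i n.
Proof.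
move=> F0 dF; elim=> [|n IHn].
  rewrite F0 power_sum0 mulr0 add0r big1 // => i _.
  by rewrite power_sum0 mulr0.
rewrite -[F n.+1](subrK (F n)) dF IHn power_sumS.
under [X in _ = _ + X]eq_bigr do rewrite power_sumS mulrDr.
by rewrite big_split /=; ring.
Qed.

(** Brings a remainder to the form that [sum_differences] expects: [j] and the size bound fix the
    two ends of the exponent range. *)
Lemma exprM_horner (R : comNzRingType) (p : {poly R}) (s j : nat) (x : R) :
    (size p <= s)%N ->
  x ^+ j * p.[x] = \sum_(j <= i < j + s) p`_(i - j) * x ^+ i.
Proof.
move=> szp; rewrite (horner_coef_wide _ szp) mulr_sumr.
rewrite -[X in index_iota X _]add0n big_addn addKn big_mkord.
by apply: eq_bigr => i _; rewrite addnK exprD; ring.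
Qed.

Lemma exprn_power_sum k n :
  n%:R ^+ k.+1 = k.+1%:R * power_sum k n
    + \sum_(0 <= i < k) - (-1) ^+ (k.+1 - i) * 'C(k.+1, i)%:R * power_sum i n.
Proof.
apply: (@sum_differences (fun n => n%:R ^+ k.+1)); first by rewrite expr0n.
move=> m; rewrite big_mkord.
(* The binomial expansion must be in powers of [m.+1]; its top term cancels and the next one gives
   the coefficient [k.+1]. *)
have -> : (m%:R : rat) = -1 + m.+1%:R by rewrite -natr1 addrC addrK.
rewrite exprDn !big_ord_recr /= subnn subSnn binn binSn.
rewrite (eq_bigr (fun i : 'I_k =>
  - (- (-1) ^+ (k.+1 - i) * 'C(k.+1, i)%:R * m.+1%:R ^+ i))); last first.
  by move=> i _; ring.
by rewrite sumrN; ring.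
Qed.

(** The hypothesis stops below [k] so that an induction hypothesis can be supplied for it. *)
Lemma power_sum_combination_poly (a : nat -> rat) k :
    (forall i, (i < k)%N -> exists q : {poly rat},
       (size q <= i.+1)%N /\ forall n, power_sum i n = n%:R * q.[n%:R]) ->
  exists p : {poly rat}, (size p <= k)%N /\
    forall n, \sum_(0 <= i < k) a i * power_sum i n = n%:R * p.[n%:R].
Proof.
move=> H; have /fin_all_exists[q Hq] (i : 'I_k) := H i (ltn_ord i).
exists (\sum_(i < k) a i *: q i); split=> [|n].
  apply: leq_trans (size_sum _ _ _) _; apply/bigmax_leqP => i _.
  apply: leq_trans (size_scale_leq _ _) _.
  by apply: leq_trans (ltn_ord i); case: (Hq i).
rewrite big_mkord horner_sum mulr_sumr; apply: eq_bigr => i _.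
by rewrite hornerZ mulrCA; case: (Hq i) => _ ->.
Qed.

(** Strong induction: [exprn_power_sum] is solved for [power_sum k], whose coefficient [k.+1] is
    invertible. *)
Lemma power_sum_poly k : exists q : {poly rat},
  (size q <= k.+1)%N /\ forall n, power_sum k n = n%:R * q.[n%:R].
Proof.
elim/ltn_ind: k => k IH.
have [p [szp Hp]] := power_sum_combination_poly
  (fun i => - (-1) ^+ (k.+1 - i) * 'C(k.+1, i)%:R) IH.
exists (k.+1%:R^-1 *: ('X^k - p)); split=> [|n].
  apply: leq_trans (size_scale_leq _ _) _.
  apply: leq_trans (size_polyD _ _) _.
  by rewrite geq_max size_polyXn size_polyN leqnn leqW.
have k1 : k.+1%:R != 0 :> rat by rewrite pnatr_eq0.
apply: (mulfI k1); rewrite hornerZ hornerD hornerN hornerXn mulrCA mulVKf //.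
by rewrite mulrBr -Hp -exprS exprn_power_sum addrK.
Qed.

(** Expand both leading powers by [exprn_power_sum]. The first contributes [power_sum k] with
    coefficient [- k.+1 / 2] (by [bin_k]), the second with [k.+1 / 2]; these cancel, so only sums of
    index below [k] remain for [p]. *)
Lemma faulhaber k : exists p : {poly rat}, (size p <= k)%N /\ forall n,
  power_sum k.+1 n =
    n%:R ^+ k.+2 / k.+2%:R + n%:R ^+ k.+1 / 2 + n%:R * p.[n%:R].
Proof.
pose a j i : rat := - (-1) ^+ (j - i) * 'C(j, i)%:R.
have [p [szp Hp]] := @power_sum_combination_poly
  (fun i => - (a k.+2 i / k.+2%:R + a k.+1 i / 2)) k
  (fun i _ => power_sum_poly i).
exists p; split=> // n; rewrite -Hp.
have bin_k : 'C(k.+2, k)%:R = k.+2%:R * k.+1%:R / 2 :> rat.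
  rewrite -bin_sub ?leqW // !subSn ?leqW // subnn.
  have /= := mul_bin_diag k.+2 1; rewrite bin1 -natrM => ->.
  by rewrite natrM mulrC mulKf.
have -> : \sum_(0 <= i < k) - (a k.+2 i / k.+2%:R + a k.+1 i / 2)
            * power_sum i n
  = - ((\sum_(0 <= i < k) a k.+2 i * power_sum i n) / k.+2%:R
       + (\sum_(0 <= i < k) a k.+1 i * power_sum i n) / 2).
  rewrite !mulr_suml -big_split -sumrN /=.
  by apply: eq_bigr => i _; ring.
have k2 : k.+2%:R != 0 :> rat by rewrite pnatr_eq0.
rewrite !exprn_power_sum big_nat_recr //= bin_k.
have -> : (k.+2 - k = 2)%N by rewrite !subSn ?leqW // subnn.
set A := \sum_(0 <= i < k) _; set B := \sum_(0 <= i < k) _.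
by field; rewrite -natrD.
Qed.

Theorem mainTheorem1 (r : nat) (hr : (0 < r)%N) :
  exists d e : nat -> rat, forall n : nat, (0 < n)%N ->
    power_sum (2 * r + 1)%N n =
      (r%:R + 1) / 2 *
        (power_sum r n ^+ 2 -
         \sum_(r <= i < (2 * r)%N) d i * power_sum i n)
    /\
    power_sum (2 * r + 2)%N n =
      (r%:R + 1) * (r%:R + 2) / (2 * r%:R + 3) *
        (power_sum r n * power_sum r.+1 n -
         \sum_(r.+1 <= i < (2 * r).+1%N) e i * power_sum i n).
Proof.
case: r hr => // k _; set r := k.+1.
have [p [szp Sp]] := faulhaber k; have [q [szq Sq]] := faulhaber k.+1.
have szXp : (size ('X * p)%R <= r)%N.
  apply: leq_trans (size_polyMleq _ _) _.
  by rewrite size_polyX add2n /= ltnS.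
have szd : (size (2 *: ('X * p))%R <= r)%N.
  exact: leq_trans (size_scale_leq _ _) szXp.
have sze : (size (q + 'X * p)%R <= r)%N.
  by apply: leq_trans (size_polyD _ _) _; rewrite geq_max szq.
(* With x = n, the differences are 2 x^(2r+1)/(r+1) + x^r (2 x p(x)) and (1/(r+1) + 1/(r+2))
   x^(2r+2) + x^(r+1) (q(x) + x p(x)); the witnesses are the shifted coefficients of the
   remainders. *)
exists (fun i => (2 *: ('X * p))`_(i - r)).
exists (fun i => (q + 'X * p)`_(i - r.+1)) => n _; split.
  rewrite mul2n -addnn (@sum_differences (fun n => power_sum r n ^+ 2)
    (2 / r.+1%:R) (fun i => (2 *: ('X * p))`_(i - r)) (r + r + 1) r (r + r)).
  - by rewrite addrK -[r.+1%:R]natr1; field; rewrite natr1 pnatr_eq0.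
  - by rewrite power_sum0 expr0n.
  move=> m; rewrite -exprM_horner //.
  (* Everything is expressed at [m.+1], so that [Sp] leaves an identity in the single variable
     [x]. *)
  have -> : power_sum r m = power_sum r m.+1 - m.+1%:R ^+ r.
    by rewrite power_sumS addrK.
  rewrite Sp hornerZ hornerM hornerX /r addn1 -addnS exprD !(exprS _ k.+1).
  set x := m.+1%:R.
  by field; rewrite -natrD pnatr_eq0.
rewrite mul2n -addnn -addSn (@sum_differences
  (fun n => power_sum r n * power_sum r.+1 n)
  ((2 * r%:R + 3) / (r.+1%:R * r.+2%:R)) (fun i => (q + 'X * p)`_(i - r.+1))
  (r + r + 2) r.+1 (r.+1 + r)).
- rewrite addrK addnn -mul2n.
  by field; rewrite -natrM nat1r -!natrD !pnatr_eq0 addn3.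
- by rewrite power_sum0 mul0r.
move=> m; rewrite -exprM_horner //.
have -> : power_sum r m = power_sum r m.+1 - m.+1%:R ^+ r.
  by rewrite power_sumS addrK.
have -> : power_sum r.+1 m = power_sum r.+1 m.+1 - m.+1%:R ^+ r.+1.
  by rewrite power_sumS addrK.
rewrite Sp Sq hornerD hornerM hornerX /r addn2 -!addnS exprD.
rewrite !(exprS _ k.+2) !(exprS _ k.+1).
set x := m.+1%:R.
by field; rewrite -!natrD !pnatr_eq0.
Qed.
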